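(* Let $G$ be an abelian group (written additively) and let $A,B\subseteq G$ be finite subsets with $\#A=\#B=n>1$ and $0\notin B$. Suppose that $A\cap(A+B)=\emptyset$ and that $B\cup\{0\}$ is a subgroup of $G$. Then: (i) the acyclicity sequence of any matching $f\in\mathcal{M}(A,B)$ is $\underbrace{1,1,\ldots,1}_{n\text{ times}}$; (ii) every matching $f\in\mathcal{M}(A,B)$ is acyclic.
   Context: Let $G$ be an additively written abelian group and $A,B$ non-empty finite subsets of $G$ with $\#A=\#B$ and $0\notin B$. Write $A+B=\{a+b: a\in A, b\in B\}$. A matching from $A$ to $B$ is a bijection $f:A\to B$ such that $a+f(a)\notin A$ for all $a\in A$; $\mathcal{M}(A,B)$ denotes the set of all matchings from $A$ to $B$. For a matching $f$, the multiplicity function $m_f:G\to\mathbb{Z}_{\ge 0}$ is $m_f(x)=\#\{a\in A: a+f(a)=x\}$. A matching $f:A\to B$ is acyclic if for every matching $g:A\to B$, $m_f=m_g$ implies $f=g$. The support of $f$ is $\mathrm{supp}(f)=\{x\in G: m_f(x)>0\}$. The acyclicity sequence of $f$ is the finite sequence of length $\#\mathrm{supp}(f)$ consisting of the values $m_f(x)$, $x\in\mathrm{supp}(f)$ (listed with repetition, one term per element of the support), arranged in non-increasing order. *)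

(* Defs.v *)
From mathcomp Require Import all_boot all_order all_algebra.
From mathcomp Require Import finmap.

Set Implicit Arguments.
Unset Strict Implicit.
Unset Printing Implicit Defensive.

Import GRing.Theory.
Local Open Scope fset_scope.
Local Open Scope ring_scope.

Definition sumset (G : zmodType) (A B : {fset G}) : {fset G} :=
  [fset a + b | a in A, b in B].

(* Maps A -> B are finite functions between the finite types associated with
   the sets A and B, so that Leibniz equality of maps is equality at every
   point of A. *)
Definition is_matching (G : zmodType) (A B : {fset G}) (f : {ffun A -> B}) :
  Prop := bijective f /\ forall a : A, val a + val (f a) \notin A.

Definition multiplicity (G : zmodType) (A B : {fset G}) (f : {ffun A -> B})
  (x : G) : nat := #|[set a : A | val a + val (f a) == x]|.

Definition acyclic (G : zmodType) (A B : {fset G}) (f : {ffun A -> B}) : Prop :=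
  forall g : {ffun A -> B}, is_matching g ->
    multiplicity f =1 multiplicity g -> f = g.

(* G may be infinite: the bound x \in sumset A B only serves to make the
   support a finite set, and it is redundant by in_supp below. *)
Definition supp (G : zmodType) (A B : {fset G}) (f : {ffun A -> B}) : {fset G} :=
  [fset x in sumset A B | (0 < multiplicity f x)%N].

Lemma in_supp (G : zmodType) (A B : {fset G}) (f : {ffun A -> B}) (x : G) :
  (x \in supp f) = (0 < multiplicity f x)%N.
Proof.
rewrite /supp !inE /=; apply/andb_idl => /card_gt0P [a].
rewrite inE => /eqP <-; apply/imfset2P.
by exists (val a); [exact: valP | exists (val (f a)); [exact: valP |]].
Qed.

Definition acyclicity_sequence (G : zmodType) (A B : {fset G})
  (f : {ffun A -> B}) : seq nat :=
  sort geq [seq multiplicity f x | x <- supp f].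

(* Main.v *)
(** Since B together with 0 is a subgroup H, disjointness of A and A + B says
    that distinct elements of A lie in distinct cosets of H. The coset of
    a + f a is that of a, so a sum a + f a determines a; hence multiplicities
    are at most 1, and they determine f. *)

Require Import Defs.
From mathcomp Require Import all_boot all_order all_algebra.
From mathcomp Require Import finmap.

Set Implicit Arguments.
Unset Strict Implicit.
Unset Printing Implicit Defensive.

Import GRing.Theory.
Local Open Scope fset_scope.
Local Open Scope ring_scope.

Section SubgroupMatching.

Variables (G : zmodType) (A B : {fset G}).
Hypotheses (A_disj : A `&` sumset A B = fset0)
           (B0_subgroup : zmod_closed [in 0 |` B]).

(** The difference [a - a'] equals [b' - b], so it lies in the subgroup. Either it is 0, or it
    belongs to [B] and [a = a' + (a - a')] lies in A + B, against disjointness. *)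
Lemma sum_left_inj (a a' : A) (b b' : B) :
  val a + val b = val a' + val b' -> a = a'.
Proof.
move=> eq_sum; apply/val_inj/eqP; rewrite -subr_eq0.
have diff_a : val a - val a' = val b' - val b.
  by apply/eqP; rewrite subr_eq addrAC eq_sym subr_eq eq_sym eq_sum addrC.
have : val a - val a' \in 0 |` B.
  by rewrite diff_a; apply: (B0_subgroup.2); apply/fset1UP; right; exact: fsvalP.
rewrite in_fset1U => /orP[//|diffB].
have : val a \in A `&` sumset A B.
  rewrite in_fsetI fsvalP; apply/imfset2P.
  exists (val a'); first exact: fsvalP.
  by exists (val a - val a') => //; rewrite addrC subrK.
by rewrite A_disj in_fset0.
Qed.

Lemma multiplicity_le1 (f : {ffun A -> B}) (x : G) : (multiplicity f x <= 1)%N.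
Proof.
apply/card_le1_eqP => a a'; rewrite !inE => /eqP <- /eqP eq_sum.
exact: (sum_left_inj eq_sum).
Qed.

(** The support is the image of [A] under the map sending [a] to [a + f a], which is injective by
    [sum_left_inj]. *)
Lemma card_supp (f : {ffun A -> B}) : #|` supp f| = #|` A|.
Proof.
have -> : supp f = [fset val a + val (f a) | a : A].
  apply/fsetP => x; rewrite in_supp; apply/card_gt0P/imfsetP => -[a].
    by rewrite inE => /eqP <-; exists a.
  by move=> _ ->; exists a; rewrite inE.
by rewrite card_imfset => [|a a' /sum_left_inj //]; rewrite -cardE cardfE.
Qed.

Lemma acyclicity_sequenceE (f : {ffun A -> B}) :
  acyclicity_sequence f = nseq #|` A| 1%N.
Proof.
(* Multiplicities on the support are positive and at most 1; a constant sequence is then fixed by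
   its length. *)
have /all_pred1P -> : all (pred1 1%N) (acyclicity_sequence f).
  rewrite all_sort all_map; apply/allP => x; rewrite in_supp => supp_x.
  by rewrite /= eqn_leq multiplicity_le1.
by rewrite size_sort size_map -(card_supp f).
Qed.

Lemma multiplicity_inj (f g : {ffun A -> B}) :
  multiplicity f =1 multiplicity g -> f = g.
Proof.
move=> eq_mult; apply/ffunP => a.
(* The value [a + f a] is attained by [f], hence also by [g], at some [a']. *)
have /card_gt0P[a'] : (0 < multiplicity g (val a + val (f a)))%N.
  by rewrite -eq_mult; apply/card_gt0P; exists a; rewrite inE.
(* Equal sums force [a' = a]; cancelling [a] then leaves [g a = f a]. *)
rewrite inE => /eqP eq_sum; move: eq_sum (sum_left_inj eq_sum) => /[swap] ->.
by move=> /addrI/val_inj.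
Qed.

End SubgroupMatching.

Theorem theorem3p5 (G : zmodType) (n : nat) (A B : {fset G})
  (cardA : #|` A| = n) (cardB : #|` B| = n) (n_gt1 : (1 < n)%N)
  (B_neq0 : 0 \notin B)
  (A_disj : A `&` sumset A B = fset0)
  (B0_subgroup : zmod_closed [in 0 |` B]) :
  (forall f : {ffun A -> B},
     is_matching f -> acyclicity_sequence f = nseq n 1%N) /\
  (forall f : {ffun A -> B}, is_matching f -> acyclic f).
Proof.
split=> f _; first by rewrite -cardA; apply: acyclicity_sequenceE.
by move=> g _; apply: multiplicity_inj.
Qed.
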